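(* Let $Z,W$ be additive abelian groups and $\{\cdot,\cdot\}:Z\times Z\to W$ an antisymmetric map that is additive in each variable separately, and let $G$ be the associated Heisenberg group. Assume $W$ has no $2$-torsion (if $w\in W$ and $2w=0$ then $w=0$). Let $A\subseteq G$ be a finite non-empty set with $|A\cdot A\cdot A|\le K|A|$ for some $K\ge1$. Then there exists an $O(K^{O(1)})$-approximate additive subgroup $\tilde A$ of $Z\times W$ such that $\{\pi(\tilde A),\pi(\tilde A)\}\subseteq \tilde A$ and $\iota(A)\subseteq\tilde A$, and furthermore $|A|\gtrsim K^{-O(1)}|\tilde A|$.
   Context: The Heisenberg group associated to $\{\cdot,\cdot\}$ is the set $G=Z\times W$ with group law $(z,w)\cdot(z',w')=(z+z',w+w'+\{z,z'\})$ (identity $(0,0)$, inverse $(z,w)^{-1}=(-z,-w)$). $Z\times W$ also denotes the additive direct product group, and $\iota:G\to Z\times W$ is the identity map of underlying sets. $\pi:Z\times W\to Z$ is the projection, and for $S,T\subseteq Z$, $\{S,T\}=\{\{s,t\}:s\in S,t\in T\}\subseteq W$, identified with a subset of $\{0\}\times W\subseteq Z\times W$. An $L$-approximate additive subgroup of an abelian group $V$ is a finite non-empty set $\tilde A\subseteq V$ with $-\tilde A=\tilde A$ for which there is a finite set $X\subseteq \tilde A+\tilde A$ with $-X=X$, $|X|\le L$ and $\tilde A+\tilde A\subseteq X+\tilde A$. $O(K^{O(1)})$ denotes a quantity at most $CK^C$, and $|A|\gtrsim K^{-O(1)}|\tilde A|$ means $|A|\ge C^{-1}K^{-C}|\tilde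 A|$, for an absolute constant $C$. *)

(* Defs.v *)
From HB Require Import structures.
From mathcomp Require Import all_boot all_order all_algebra.
From mathcomp Require Import finmap reals exp.

Set Implicit Arguments.
Unset Strict Implicit.
Unset Printing Implicit Defensive.

Import Order.TTheory GRing.Theory Num.Theory.
Local Open Scope fset_scope.
Local Open Scope ring_scope.

Definition sumset (V : zmodType) (S T : {fset V}) : {fset V} :=
  [fset s + t | s in S, t in T].

Definition oppset (V : zmodType) (S : {fset V}) : {fset V} :=
  [fset - s | s in S].

Definition prodset (G : groupType) (S T : {fset G}) : {fset G} :=
  [fset (s * t)%g | s in S, t in T].

Definition approx_addsubgroup (R : realType) (V : zmodType) (L : R)
    (A : {fset V}) : Prop :=
  [/\ A != fset0, oppset A = A &
      exists X : {fset V},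
        [/\ X `<=` sumset A A, oppset X = X, #|` X|%:R <= L &
            sumset A A `<=` sumset X A]].

Definition no_2torsion (W : zmodType) : Prop :=
  forall w : W, w *+ 2 = 0 -> w = 0.

Section Bracket.
Variables (Z W : zmodType) (b : Z -> Z -> W).

Definition biadditive : Prop :=
  (forall z' : Z, {morph b^~ z' : x y / x + y}) /\
  (forall z : Z, {morph b z : x y / x + y}).

(* ssrbool's [antisymmetric] is about relations, not about sign. *)
Definition antisym_bracket : Prop := forall z z' : Z, b z z' = - b z' z.

Definition bracketset (S T : {fset Z}) : {fset W} :=
  [fset b s t | s in S, t in T].

Definition heisenberg (hb : biadditive) : Type := (Z * W)%type.

End Bracket.

Definition projZ (Z W : zmodType) (S : {fset Z * W}) : {fset Z} :=
  [fset p.1 | p in S].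

Definition embW (Z W : zmodType) (S : {fset W}) : {fset Z * W} :=
  [fset (0 : Z, w) | w in S].

Section Heisenberg.
Variables (Z W : zmodType) (b : Z -> Z -> W) (hb : biadditive b).
Local Notation G := (heisenberg hb).

HB.instance Definition _ := Choice.on G.

Definition heis_mul (g h : G) : G := (g.1 + h.1, g.2 + h.2 + b g.1 h.1).

Definition heis_one : G := (0, 0).

(* Biadditivity alone makes G a group, with this inverse; the term [b z z]
   vanishes for an antisymmetric bracket when W has no 2-torsion, see
   [heis_invE]. *)
Definition heis_inv (g : G) : G := (- g.1, - g.2 + b g.1 g.1).

Lemma biadd0l z : b 0 z = 0.
Proof. by apply: (addrI (b 0 z)); rewrite -hb.1 !addr0. Qed.

Lemma biadd0r z : b z 0 = 0.
Proof. by apply: (addrI (b z 0)); rewrite -hb.2 !addr0. Qed.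

Lemma biaddNl z z' : b (- z) z' = - b z z'.
Proof. by apply: (addrI (b z z')); rewrite -hb.1 !subrr biadd0l. Qed.

Lemma biaddNr z z' : b z (- z') = - b z z'.
Proof. by apply: (addrI (b z z')); rewrite -hb.2 !subrr biadd0r. Qed.

Lemma heis_mulA : associative heis_mul.
Proof.
move=> [x u] [y v] [z w]; rewrite /heis_mul /= hb.1 hb.2; congr pair.
  by rewrite addrA.
by rewrite !addrA [LHS](ACl (1*2*5*3*6*4)%AC).
Qed.

Lemma heis_mul1 : left_id heis_one heis_mul.
Proof. by move=> [x u]; rewrite /heis_mul /= !add0r biadd0l addr0. Qed.

Lemma heis_mulr1 : right_id heis_one heis_mul.
Proof. by move=> [x u]; rewrite /heis_mul /= !addr0 biadd0r addr0. Qed.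

Lemma heis_mulV : left_inverse heis_one heis_inv heis_mul.
Proof.
move=> [x u]; rewrite /heis_mul /heis_inv /= biaddNl addNr.
by rewrite addrAC addrK addNr.
Qed.

Lemma heis_mulrV : right_inverse heis_one heis_inv heis_mul.
Proof.
by move=> [x u]; rewrite /heis_mul /heis_inv /= biaddNr addrA !subrr add0r subrr.
Qed.

HB.instance Definition _ :=
  isGroup.Build G heis_mulA heis_mul1 heis_mulr1 heis_mulV heis_mulrV.

Lemma heis_mulE (g h : G) :
  (g * h)%g = (g.1 + h.1, g.2 + h.2 + b g.1 h.1) :> G.
Proof. by []. Qed.

Lemma heis_invE (ha : antisym_bracket b) (h2 : no_2torsion W) (g : G) :
  (g^-1)%g = (- g.1, - g.2) :> G.
Proof.
rewrite -[LHS]/(heis_inv g) /heis_inv (h2 (b g.1 g.1)) ?addr0 //.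
by rewrite mulr2n {1}ha addNr.
Qed.

Definition iota_heis (g : G) : Z * W := g.

End Heisenberg.

(* Main.v *)
Require Import Defs.
From HB Require Import structures.
From mathcomp Require Import all_boot all_order all_algebra.
From mathcomp Require Import finmap reals exp.

Set Implicit Arguments.
Unset Strict Implicit.
Unset Printing Implicit Defensive.

Import Order.TTheory GRing.Theory Num.Theory.
Local Open Scope fset_scope.
Local Open Scope ring_scope.

(* Let [B] be [A], its inverses and the identity; Ruzsa's triangle inequality
   bounds all powers of [B].  With [E] the set of brackets of [B] and
   [D = B + 2E], take [At = D + D].  The sum set [5D] is small because it injects
   into [B^105]: conjugation-like products [g v g] and commutators realise in [G]
   the double of any element of [10D], and doubling is injective on [W].
   Ruzsa's covering lemma for [4D] and [D] then gives the centres. *)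

(** * Sections and cardinals of finite sets *)

(** A choice of one preimage in [P] for each value of [g]. Off the image of [P] the section takes
    the default value [x0], so only points [g v] with [v] in [P] are covered. *)
Lemma fset_section (T T' : choiceType) (x0 : T) (P : {fset T}) (g : T -> T') :
  exists s : T' -> T, forall v, v \in P -> s (g v) \in P /\ g (s (g v)) = g v.
Proof.
exists (fun y => odflt x0 (omap val [pick x : P | g (val x) == y])) => v vP.
case: pickP => [x /eqP gx | /(_ [` vP])]; last by rewrite /= eqxx.
by split; [exact: valP | ].
Qed.

Lemma leq_card_inj (T T' : choiceType) (f : T -> T') (S : {fset T})
    (S' : {fset T'}) :
  {in S &, injective f} -> {in S, forall x, f x \in S'} ->
  (#|` S| <= #|` S'|)%N.
Proof.
move=> fI fS; rewrite -(card_in_imfset imfset_key fI).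
by apply/fsubset_leq_card/fsubsetP => _ /imfsetP[x /= xS ->]; exact: fS.
Qed.

Lemma card_fsetM (T T' : choiceType) (S : {fset T}) (S' : {fset T'}) :
  #|` S `*` S'| = (#|` S| * #|` S'|)%N.
Proof.
rewrite -(size_allpairs pair (enum_fset S) (enum_fset S')).
apply/perm_size/uniq_perm; first exact: fset_uniq.
  by apply: allpairs_uniq => // -[] ? ? [].
move=> [x y]; rewrite in_fsetM /=; apply/andP/allpairsP.
  by case=> xS yS; exists (x, y).
by case=> -[a c] /= [aS cS [-> ->]].
Qed.

(** * Product sets in a group and the Ruzsa triangle inequality *)

Section GroupSets.
Variable G : groupType.
Implicit Types (S T X Y : {fset G}) (x y : G).

Definition invset S : {fset G} := [fset x^-1%g | x in S].

Definition powset S n : {fset G} := iter n (prodset S) [fset 1%g].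

Lemma mem_prodset S T x y : x \in S -> y \in T -> (x * y)%g \in prodset S T.
Proof. by move=> xS yT; apply/imfset2P; exists x => //; exists y. Qed.

Lemma prodsetP S T x :
  reflect (exists s t, [/\ s \in S, t \in T & x = (s * t)%g])
    (x \in prodset S T).
Proof.
rewrite /prodset; apply: (iffP (imfset2P _ _ _ _ _)).
  by move=> [s /= sS [t /= tT ->]]; exists s, t.
move=> [s [t [sS tT ->]]].
by exists s => //; exists t.
Qed.

Lemma mem_invset S x : (x \in invset S) = (x^-1%g \in S).
Proof.
apply/imfsetP/idP => [[y yS ->]|xS]; first by rewrite invgK.
by exists x^-1%g; rewrite ?invgK.
Qed.

Lemma invsetK : involutive invset.
Proof. by move=> S; apply/fsetP => x; rewrite !mem_invset invgK. Qed.

Lemma card_invset S : #|` invset S| = #|` S|.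
Proof. by rewrite card_imfset //; exact: invg_inj. Qed.

Lemma invset_prodset S T : invset (prodset S T) = prodset (invset T) (invset S).
Proof.
apply/fsetP => x; rewrite mem_invset; apply/prodsetP/prodsetP.
  move=> [s [t [sS tT xE]]]; exists t^-1%g, s^-1%g.
  by rewrite !mem_invset !invgK -invgM -xE invgK.
move=> [s [t []]]; rewrite !mem_invset => sS tT ->.
by exists t^-1%g, s^-1%g; rewrite invgM.
Qed.

Lemma prodsetA S T X : prodset S (prodset T X) = prodset (prodset S T) X.
Proof.
apply/fsetP => x; apply/prodsetP/prodsetP.
  move=> [s [_ [sS /prodsetP[t [u [tT uX ->]]] ->]]].
  by exists (s * t)%g, u; rewrite mulgA mem_prodset.
move=> [_ [u [/prodsetP[s [t [sS tT ->]]] uX ->]]].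
by exists s, (t * u)%g; rewrite mulgA mem_prodset.
Qed.

Lemma prod1set S : prodset [fset 1%g] S = S.
Proof.
apply/fsetP => x; apply/prodsetP/idP => [[_ [t [/fset1P-> tS ->]]]|xS].
  by rewrite mul1g.
by exists 1%g, x; rewrite mul1g fset11.
Qed.

Lemma prodset1 S : prodset S [fset 1%g] = S.
Proof.
apply/fsetP => x; apply/prodsetP/idP => [[s [_ [sS /fset1P-> ->]]]|xS].
  by rewrite mulg1.
by exists x, 1%g; rewrite mulg1 fset11.
Qed.

Lemma prodsetUl S T X : prodset (S `|` T) X = prodset S X `|` prodset T X.
Proof.
apply/fsetP => x; rewrite inE; apply/prodsetP/orP.
  move=> [s [t []]]; rewrite inE => /orP[sS|sT] tX ->.
    by left; apply: mem_prodset.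
  by right; apply: mem_prodset.
by case=> /prodsetP[s [t [sS tX ->]]]; exists s, t; rewrite inE sS ?orbT.
Qed.

Lemma prodsetUr S T X : prodset X (S `|` T) = prodset X S `|` prodset X T.
Proof.
apply/fsetP => x; rewrite inE; apply/prodsetP/orP.
  move=> [s [t [sX]]]; rewrite inE => /orP[tS|tT] ->.
    by left; apply: mem_prodset.
  by right; apply: mem_prodset.
by case=> /prodsetP[s [t [sX tS ->]]]; exists s, t; rewrite inE tS ?orbT.
Qed.

Lemma powset_add S m n : powset S (m + n) = prodset (powset S m) (powset S n).
Proof.
by elim: m => [|m IHm]; rewrite ?prod1set // addSn /= IHm prodsetA.
Qed.

Lemma mem_powsetM S m n x y :
  x \in powset S m -> y \in powset S n -> (x * y)%g \in powset S (m + n).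
Proof. by rewrite powset_add; exact: mem_prodset. Qed.

Lemma powset1 S : powset S 1 = S.
Proof. exact: prodset1. Qed.

Lemma leq_card_prodsetl S T x : x \in S -> (#|` T| <= #|` prodset S T|)%N.
Proof.
move=> xS; apply: (@leq_card_inj _ _ (fun y => x * y)%g); first by move=> y z _ _ /mulgI.
move=> y yT; exact: mem_prodset.
Qed.

Lemma leq_card_prodsetr S T x : x \in T -> (#|` S| <= #|` prodset S T|)%N.
Proof.
move=> xT; apply: (@leq_card_inj _ _ (fun y => y * x)%g); first by move=> y z _ _ /mulIg.
move=> y yS; exact: mem_prodset.
Qed.

(** Fix a factorisation [u = x y] for each [u] in [X Y] and send [(u, t)] to [(x t, t^-1 y)]. The
    product of the two entries is [u], which determines [x], and then [t] by cancellation, so the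
    map is injective. *)
Lemma ruzsa_triangle X Y T :
  (#|` prodset X Y| * #|` T| <=
   #|` prodset X T| * #|` prodset (invset T) Y|)%N.
Proof.
have [s sP] := fset_section (1%g, 1%g) (X `*` Y) (fun p => (p.1 * p.2)%g).
have {}sP u : u \in prodset X Y ->
    [/\ (s u).1 \in X, (s u).2 \in Y & ((s u).1 * (s u).2)%g = u].
  move=> /prodsetP[x [y [xX yY ->]]].
  have /sP[/=] : (x, y) \in X `*` Y by rewrite in_fsetM xX yY.
  by rewrite in_fsetM => /andP[].
rewrite -!card_fsetM.
apply: (@leq_card_inj _ _
  (fun p => (((s p.1).1 * p.2)%g, (p.2^-1 * (s p.1).2)%g))).
  move=> [u t] [u' t']; rewrite !in_fsetM /=.
  move=> /andP[/sP[_ _ uE] _] /andP[/sP[_ _ uE'] _] [e1 e2].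
  have uu' : u = u'.
    rewrite -uE -uE' -(mulgK t (s u).1) e1.
    by rewrite -[X in X = _]mulgA e2 mulgA mulgK.
  by rewrite uu' in e1 *; move/mulgI: e1 => ->.
move=> [u t]; rewrite !in_fsetM /= => /andP[/sP[xX yY _] tT].
by rewrite !mem_prodset // mem_invset invgK.
Qed.

(** * Small tripling and the growth of powers *)

Definition signset S (inv : bool) : {fset G} := if inv then invset S else S.

(* The three-fold products of [S] and [S^-1] with any pattern of inverses are
   reached from [SSS] by at most two applications of the triangle inequality. *)
Lemma card_signed_tripling S (b1 b2 b3 : bool) (R : realFieldType) (K : R) :
  S != fset0 -> 1 <= K ->
  #|` prodset (prodset S S) S|%:R <= K * #|` S|%:R ->
  #|` prodset (prodset (signset S b1) (signset S b2)) (signset S b3)|%:R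
    <= K ^+ 3 * #|` S|%:R.
Proof.
move=> /fset0Pn[x0 x0S] K1 SSS.
have S0 : 0 < #|` S|%:R :> R.
  by rewrite ltr0n cardfs_gt0; apply/fset0Pn; exists x0.
have K0 : 0 <= K by apply: le_trans K1.
(* The triangle inequality with exponents of [K] added; the middle set is [S] or its inverse, so its
   cardinal cancels one factor [#|S|]. *)
have triangle X Y U p q r : U = S \/ U = invset S ->
    #|` prodset X U|%:R <= K ^+ p * #|` S|%:R ->
    #|` prodset (invset U) Y|%:R <= K ^+ q * #|` S|%:R ->
    r = (p + q)%N -> #|` prodset X Y|%:R <= K ^+ r * #|` S|%:R.
  move=> US h1 h2 ->; rewrite -(ler_pM2r S0).
  have cU : #|` U| = #|` S| by case: US => ->; rewrite ?card_invset.
  apply: le_trans (_ : #|` prodset X U|%:R * #|` prodset (invset U) Y|%:R <= _).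
    by rewrite -!natrM ler_nat -cU ruzsa_triangle.
  apply: le_trans (ler_pM _ _ h1 h2) _ => //.
  by rewrite exprD mulrACA mulrA.
have inv3 X Y U r : #|` prodset (prodset X Y) U|%:R <= K ^+ r * #|` S|%:R ->
    #|` prodset (prodset (invset U) (invset Y)) (invset X)|%:R
      <= K ^+ r * #|` S|%:R.
  by rewrite -prodsetA -!invset_prodset card_invset.
have up X Y U p r : (p <= r)%N ->
    #|` prodset (prodset X Y) U|%:R <= K ^+ p * #|` S|%:R ->
    #|` prodset (prodset X Y) U|%:R <= K ^+ r * #|` S|%:R.
  by move=> pr /le_trans; apply; rewrite ler_pM2r // ler_weXn2l.
have h000 : #|` prodset (prodset S S) S|%:R <= K ^+ 1 * #|` S|%:R by [].
have h00 : #|` prodset S S|%:R <= K ^+ 1 * #|` S|%:R.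
  by apply: le_trans SSS; rewrite ler_nat; apply: leq_card_prodsetr x0S.
have h11 : #|` prodset (invset S) (invset S)|%:R <= K ^+ 1 * #|` S|%:R.
  by rewrite -invset_prodset card_invset.
have h001 : #|` prodset (prodset S S) (invset S)|%:R <= K ^+ 2 * #|` S|%:R.
  by apply: (triangle _ _ S 1 1) => //; left.
have h100 : #|` prodset (prodset (invset S) S) S|%:R <= K ^+ 2 * #|` S|%:R.
  rewrite -prodsetA.
  by apply: (triangle _ _ (invset S) 1 1); rewrite ?invsetK ?prodsetA //; right.
have h110 := inv3 _ _ _ _ h100; rewrite invsetK in h110.
have h011 := inv3 _ _ _ _ h001; rewrite invsetK in h011.
(* The costliest pattern [S S^-1 S]: the middle set [S] leads to [S S] with exponent 1 and to
   [S^-1 S^-1 S] with exponent 2. *)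
have h010 : #|` prodset (prodset S (invset S)) S|%:R <= K ^+ 3 * #|` S|%:R.
  rewrite -prodsetA.
  by apply: (triangle _ _ S 1 2); rewrite ?prodsetA //; left.
have h101 := inv3 _ _ _ _ h010; rewrite invsetK in h101.
have h111 := inv3 _ _ _ _ h000.
case: b1 b2 b3 => [] [] [] /=; first [exact: up h111 | exact: up h110 |
  exact: up h101 | exact: up h100 | exact: up h011 | exact: up h010 |
  exact: up h001 | exact: up h000].
Qed.

(** Induction by the triangle inequality with middle set [S = S^-1], applied to [S^(n+2)] and [S^2]:
    it bounds [|S^(n+4)| |S|] by [|S^(n+3)| |S^3|], so each further factor [S] costs one [K]. *)
Lemma card_powset_tripling S n (R : realFieldType) (K : R) :
  S != fset0 -> invset S = S -> 0 <= K ->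
  #|` powset S 3|%:R <= K * #|` S|%:R ->
  #|` powset S n.+3|%:R <= K ^+ n.+1 * #|` S|%:R.
Proof.
move=> S0 SV K0 S3; elim: n => [//|n IHn].
have cS : 0 < #|` S|%:R :> R by rewrite ltr0n cardfs_gt0.
rewrite -(ler_pM2r cS) [leRHS](_ : _ = K ^+ n.+1 * #|` S|%:R * (K * #|` S|%:R)).
  apply: le_trans (ler_pM _ _ IHn S3) => //.
  rewrite -!natrM ler_nat.
  have := ruzsa_triangle (powset S n.+2) (powset S 2) S.
  rewrite -powset_add addn2 SV -[prodset S (powset S 2)]/(powset S 3).
  by rewrite -[in X in prodset _ X](powset1 S) -powset_add addn1.
by rewrite [K ^+ n.+2]exprSr mulrACA mulrA.
Qed.

Definition symset S : {fset G} := 1%g |` (S `|` invset S).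

Lemma invset_symset S : invset (symset S) = symset S.
Proof.
apply/fsetP => x; rewrite mem_invset !inE !mem_invset invgK.
by rewrite invg_eq1 [(_^-1%g \in S) || _]orbC.
Qed.

(** With [Q] the union of [S] and [S^-1], the cube of the symmetrised set is the union of [1], [Q],
    [Q^2] and [Q^3]. The largest, [Q^3], is a union of 8 signed triple products; four sets of this
    size give the factor 32. *)
Lemma card_symset_tripling S (R : realFieldType) (K : R) :
  S != fset0 -> 1 <= K ->
  #|` prodset (prodset S S) S|%:R <= K * #|` S|%:R ->
  #|` powset (symset S) 3|%:R <= 32 * K ^+ 3 * #|` S|%:R.
Proof.
move=> S0 K1 SSS; have S3 := card_signed_tripling _ _ _ S0 K1 SSS.
set c := K ^+ 3 * #|` S|%:R in S3.
pose Q := S `|` invset S; pose T := signset S.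
have cardU (X Y : {fset G}) (m : R) : #|` X|%:R <= m -> #|` Y|%:R <= m ->
    #|` X `|` Y|%:R <= m *+ 2.
  move=> Xm Ym; apply: le_trans (_ : (#|` X| + #|` Y|)%:R <= _).
    by rewrite ler_nat cardfsU leq_subr.
  by rewrite natrD mulr2n lerD.
have Q3 : #|` prodset (prodset Q Q) Q|%:R <= c *+ 2 *+ 2 *+ 2.
  have h1 (x y : bool) : #|` prodset (prodset (T x) (T y)) Q|%:R <= c *+ 2.
    rewrite prodsetUr cardU //; first exact: (S3 x y false).
    exact: (S3 x y true).
  have h2 (x : bool) : #|` prodset (prodset (T x) Q) Q|%:R <= c *+ 2 *+ 2.
    rewrite [prodset (T x) Q]prodsetUr prodsetUl cardU //.
      exact: (h1 x false).
    exact: (h1 x true).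
  rewrite [prodset Q Q]prodsetUl prodsetUl cardU //.
    exact: (h2 false).
  exact: (h2 true).
have [x0 x0Q] : exists x, x \in Q.
  by have /fset0Pn[x xS] := S0; exists x; rewrite inE xS.
have SQ : symset S = 1%g |` Q by [].
clearbody Q.
have Q2 : (#|` prodset Q Q| <= #|` prodset (prodset Q Q) Q|)%N.
  exact: leq_card_prodsetr x0Q.
have Q1 : (#|` Q| <= #|` prodset Q Q|)%N by exact: leq_card_prodsetr x0Q.
have one : (#|` [fset 1%g : G]| <= #|` Q|)%N.
  by rewrite cardfs1 cardfs_gt0; apply/fset0Pn; exists x0.
have BE : powset (symset S) 3 =
    ([fset 1%g] `|` Q) `|` (prodset Q Q `|` prodset (prodset Q Q) Q).
  rewrite SQ /powset /= prodset1 !(prodsetUl, prodsetUr).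
  rewrite !(prodset1, prod1set) prodsetA.
  by apply/fsetP => x; rewrite !in_fsetU; do 4?[case: (_ \in _) => //=].
have -> : 32 * K ^+ 3 * #|` S|%:R = c *+ 2 *+ 2 *+ 2 *+ 2 *+ 2.
  by rewrite -mulrA -/c -!mulrnA mulr_natl.
clearbody c.
rewrite BE; apply: (cardU); apply: (cardU); apply: le_trans Q3; rewrite ler_nat.
- by apply: leq_trans one _; apply: leq_trans Q1 _.
- by apply: leq_trans Q1 _.
- exact: Q2.
- by [].
Qed.

End GroupSets.

(** * Sum sets in an abelian group and Ruzsa's covering lemma *)

Section AdditiveSets.
Variable V : zmodType.
Implicit Types (S T D X : {fset V}) (v w : V).

Lemma mem_sumset S T v w : v \in S -> w \in T -> v + w \in sumset S T.
Proof. by move=> vS wT; apply/imfset2P; exists v => //; exists w. Qed.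

Lemma sumsetP S T v :
  reflect (exists s t, [/\ s \in S, t \in T & v = s + t]) (v \in sumset S T).
Proof.
rewrite /sumset; apply: (iffP (imfset2P _ _ _ _ _)).
  by move=> [s /= sS [t /= tT ->]]; exists s, t.
move=> [s [t [sS tT ->]]].
by exists s => //; exists t.
Qed.

Lemma oppset_id S : {in S, forall v, - v \in S} -> oppset S = S.
Proof.
move=> SN; apply/fsetP => v; apply/imfsetP/idP => [[w /= wS ->]|vS].
  exact: SN.
by exists (- v); rewrite ?opprK //; exact: SN.
Qed.

Lemma mem_oppset S v : (v \in oppset S) = (- v \in S).
Proof.
apply/imfsetP/idP => [[w wS ->]|vS]; first by rewrite opprK.
by exists (- v); rewrite ?opprK.
Qed.

Lemma sumset_oppr S T :
  {in S, forall v, - v \in S} -> {in T, forall v, - v \in T} ->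
  {in sumset S T, forall v, - v \in sumset S T}.
Proof.
move=> SN TN _ /sumsetP[s [t [sS tT ->]]].
by rewrite opprD mem_sumset ?SN ?TN.
Qed.

(* Greedy choice of the centres: [v] is added when [v + D] is disjoint from the
   translates of [D] selected so far. *)
Lemma ruzsa_covering S D : D != fset0 -> exists X : {fset V},
  [/\ X `<=` S, (#|` X| * #|` D| <= #|` sumset S D|)%N &
      {in S, forall v, exists x d d',
        [/\ x \in X, d \in D, d' \in D & v = x + (d - d')]}].
Proof.
move=> /fset0Pn[d0 d0D].
have greedy (s : seq V) : exists X : {fset V},
    [/\ {subset X <= s},
        forall x x' d d', x \in X -> x' \in X -> d \in D -> d' \in D ->
          x + d = x' + d' -> x = x' &
        {in s, forall v, exists x d d',
          [/\ x \in X, d \in D, d' \in D & v = x + (d - d')]}].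
  elim: s => [|v s [X [Xs Xdisj Xcov]]]; first by exists fset0.
  (* Lying outside [X + D - D] means exactly that [v + D] is disjoint from every [x + D], so this
     test decides whether [v] becomes a centre. *)
  have [|vN] := boolP (v \in sumset X (sumset D (oppset D))).
    move=> /sumsetP[x [e [xX]]].
    move=> /sumsetP[d [d' [dD]]]; rewrite mem_oppset => d'D -> ->.
    exists X; split=> // [y /Xs ys|y]; first by rewrite inE ys orbT.
    rewrite inE => /predU1P[->|/Xcov//].
    by exists x, d, (- d'); rewrite opprK.
  have vX x d d' : x \in X -> d \in D -> d' \in D -> v + d <> x + d'.
    move=> xX dD d'D vE; move/negP: vN; apply; rewrite -(addrK d v) vE -addrA.
    by rewrite !mem_sumset // mem_oppset opprK.
  exists (v |` X); split=> [y|x x' d d'|y].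
  - by rewrite !inE => /predU1P[->|/Xs ->]; rewrite ?eqxx ?orbT.
  - rewrite !inE => /predU1P[->|xX] /predU1P[->|x'X] dD d'D // E.
    + by case: (vX x' d d').
    + by case: (vX x d' d).
    + exact: Xdisj E.
  - rewrite inE => /predU1P[->|/Xcov[x [d [d' [xX dD d'D ->]]]]].
      by exists v, d0, d0; rewrite subrr addr0 fset1U1.
    by exists x, d, d'; rewrite fset1Ur.
have [X [XS Xdisj Xcov]] := greedy (enum_fset S).
exists X; split=> //; first exact/fsubsetP.
(* Disjointness of the translates makes addition injective on pairs from [X] and [D], whence the
   cardinal bound. *)
rewrite -card_fsetM; apply: (@leq_card_inj _ _ (fun p => p.1 + p.2)).
  move=> [x d] [x' d']; rewrite !in_fsetM /= => /andP[xX dD] /andP[x'X d'D] E.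
  have xx' := Xdisj _ _ _ _ xX x'X dD d'D E.
  by move: E; rewrite xx' => /addrI ->.
move=> [x d]; rewrite in_fsetM /= => /andP[xX dD].
by rewrite mem_sumset //; exact: XS.
Qed.

Definition nsumset S n : {fset V} := iter n (sumset S) [fset 0].

Lemma nsumset1 S : nsumset S 1 = S.
Proof.
apply/fsetP => v; apply/sumsetP/idP => [[s [_ [sS /fset1P-> ->]]]|vS].
  by rewrite addr0.
by exists v, 0; rewrite addr0 fset11.
Qed.

Lemma sumsetA S T X : sumset S (sumset T X) = sumset (sumset S T) X.
Proof.
apply/fsetP => v; apply/sumsetP/sumsetP.
  move=> [s [_ [sS /sumsetP[t [u [tT uX ->]]] ->]]].
  by exists (s + t), u; rewrite addrA mem_sumset.
move=> [_ [u [/sumsetP[s [t [sS tT ->]]] uX ->]]].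
by exists s, (t + u); rewrite addrA mem_sumset.
Qed.

Lemma sum0set S : sumset [fset 0] S = S.
Proof.
apply/fsetP => v; apply/sumsetP/idP => [[_ [t [/fset1P-> tS ->]]]|vS].
  by rewrite add0r.
by exists 0, v; rewrite add0r fset11.
Qed.

Lemma nsumset_add S m n :
  nsumset S (m + n) = sumset (nsumset S m) (nsumset S n).
Proof.
by elim: m => [|m IHm]; rewrite ?sum0set // addSn /= IHm sumsetA.
Qed.

Lemma nsumset2 S : nsumset S 2 = sumset S S.
Proof. by rewrite (nsumset_add S 1 1) nsumset1. Qed.

Lemma mem_nsumsetD S m n v w :
  v \in nsumset S m -> w \in nsumset S n -> v + w \in nsumset S (m + n).
Proof. by rewrite nsumset_add; exact: mem_sumset. Qed.

Lemma mem_nsumset0 S n : 0 \in S -> 0 \in nsumset S n.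
Proof.
move=> S0; elim: n => [|n IHn]; first exact: fset11.
by rewrite -[0]addr0 /=; exact: mem_sumset.
Qed.

Lemma nsumset_sub S m n : 0 \in S -> (m <= n)%N -> nsumset S m `<=` nsumset S n.
Proof.
move=> S0 /subnKC<-; apply/fsubsetP => v vS; rewrite -[v]addr0.
exact: mem_nsumsetD vS (mem_nsumset0 _ S0).
Qed.

Lemma nsumset_oppr S n : {in S, forall v, - v \in S} ->
  {in nsumset S n, forall v, - v \in nsumset S n}.
Proof.
move=> SN; elim: n => [|n IHn]; last exact: sumset_oppr.
by move=> _ /fset1P->; rewrite oppr0 fset11.
Qed.

End AdditiveSets.

(** * Doubling in the direct product, expressed by the Heisenberg law *)

Section HeisenbergSets.
Variables (Z W : zmodType) (b : Z -> Z -> W) (hb : biadditive b).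
Hypotheses (ha : antisym_bracket b) (h2 : no_2torsion W).
Local Notation G := (heisenberg hb).
Implicit Types (g h : G) (v w : Z * W).

(** The double is computed in the additive group [Z * W] and then read in [G]. *)
Definition dbl v : G := v *+ 2.

Lemma bracket_alternating z : b z z = 0.
Proof. by apply: h2; rewrite mulr2n {1}ha addNr. Qed.

(** The cross terms, the brackets of [g.1] with [2 v.1] and of [2 v.1] with [g.1], cancel by
    antisymmetry. Multiplying by [g] on both sides thus adds twice [g] without a bracket. *)
Lemma dblD_conj v g : dbl (v + iota_heis g) = (g * dbl v * g)%g.
Proof.
case: v g => [z w] [x u]; rewrite /dbl /iota_heis mulr2n !heis_mulE /=.
rewrite hb.1 hb.2 bracket_alternating add0r (ha (z + z)).
rewrite [RHS]surjective_pairing /=.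
congr pair.
  by rewrite !addrA [LHS](ACl (2*1*3*4)%AC).
rewrite -[LHS]/(w + u + (w + u)) hb.2 [RHS](ACl (1*2*4*(3*5))%AC) /=.
rewrite subrr addr0.
by rewrite !addrA [LHS](ACl (2*1*3*4)%AC).
Qed.

(** The commutator of [g] and [h] is central and equals [(0, 2 b g.1 h.1)]. Brackets are reached
    only doubled, which is why doubles are tracked. *)
Lemma dblD_comm v g h :
  dbl (v + (0, b g.1 h.1)) = (dbl v * (g * h * g^-1 * h^-1))%g.
Proof.
case: v g h => [z w] [x u] [x' u'].
rewrite /dbl mulr2n !(heis_invE ha h2) !heis_mulE /=.
have xE : x + x' - x = x' by rewrite addrAC subrr add0r.
rewrite xE subrr (biadd0r hb) !addr0 !(biaddNr hb) hb.1 !bracket_alternating.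
rewrite add0r oppr0 addr0 -(ha x x').
rewrite -[LHS]/(z + 0 + (z + 0), w + b x x' + (w + b x x')) !addr0; congr pair.
rewrite [u + u' + _ + _ + _ + _](ACl ((1*4)*(2*6)*(3*5))%AC) /= !subrr !add0r.
by rewrite addrACA.
Qed.

(** * The thickened set: its sum sets and its brackets *)

Section Thickening.
Variable B : {fset G}.
Hypotheses (B1 : 1%g \in B) (BV : invset B = B).

Let iB : {fset Z * W} := [fset iota_heis g | g in B].
Let E := embW Z (bracketset b (projZ iB) (projZ iB)).

(* Two copies of [E] in each summand, so that [D + D] contains the brackets of
   its own elements, which are sums of four elements of [E]. *)
Definition thickening : {fset Z * W} := sumset (sumset iB E) E.
Local Notation D := thickening.

Lemma mem_iota_set v : (v \in iB) = ((v : G) \in B).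
Proof. by apply/imfsetP/idP => [[g gB ->]//|vB]; exists v. Qed.

Lemma projZ_iotaP z : reflect (exists2 g, g \in B & z = g.1) (z \in projZ iB).
Proof.
apply: (iffP (imfsetP _ _ _ _)) => [[g /=]|[g gB ->]].
  by rewrite mem_iota_set => gB ->; exists g.
by exists (g : Z * W); rewrite //= mem_iota_set.
Qed.

Lemma bracketsP v :
  reflect (exists g h, [/\ g \in B, h \in B & v = (0, b g.1 h.1)]) (v \in E).
Proof.
apply: (iffP (imfsetP _ _ _ _)) => [[w /= /imfset2P[_ /projZ_iotaP[g gB ->]]]|].
  by move=> [_ /projZ_iotaP[h hB ->] -> ->]; exists g, h.
move=> [g [h [gB hB ->]]]; exists (b g.1 h.1) => //=.
apply/imfset2P; exists g.1 => /=; first by apply/projZ_iotaP; exists g.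
by exists h.1 => //=; apply/projZ_iotaP; exists h.
Qed.

Lemma mem_invg g : g \in B -> (g^-1)%g \in B.
Proof. by rewrite -{1}BV mem_invset. Qed.

Lemma iota_set_oppr : {in iB, forall v, - v \in iB}.
Proof.
by move=> v; rewrite !mem_iota_set => /mem_invg; rewrite (heis_invE ha h2).
Qed.

Lemma brackets_oppr : {in E, forall v, - v \in E}.
Proof.
move=> _ /bracketsP[g [h [gB hB ->]]]; apply/bracketsP; exists h, g; split=> //.
by rewrite (ha h.1) -[LHS]/(- (0 : Z), - b g.1 h.1) oppr0.
Qed.

Lemma brackets0 : 0 \in E.
Proof.
by apply/bracketsP; exists 1%g, 1%g; split=> //; rewrite (biadd0l hb).
Qed.

Lemma iota_set0 : 0 \in iB.
Proof. by rewrite mem_iota_set. Qed.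

Lemma thickening_oppr : {in D, forall v, - v \in D}.
Proof.
exact: sumset_oppr (sumset_oppr iota_set_oppr brackets_oppr) brackets_oppr.
Qed.

Lemma mem_thickening_B v : v \in iB -> v \in D.
Proof. by move=> vB; rewrite -[v]addr0 -[v]addr0 !mem_sumset ?brackets0. Qed.

Lemma thickening0 : 0 \in D.
Proof. exact: mem_thickening_B iota_set0. Qed.

(** A summand of [D] is an element of [B] plus two brackets. The first costs two factors, one on
    each side, and each bracket costs a commutator of four: [2 + 4 + 4 = 10]. *)
Lemma dblD_thickening v d n : d \in D -> dbl v \in powset B n ->
  dbl (v + d) \in powset B (n + 10).
Proof.
have addE u e m : e \in E -> dbl u \in powset B m ->
    dbl (u + e) \in powset B (m + 4).
  move=> /bracketsP[g [h [gB hB ->]]] uB; rewrite dblD_comm.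
  apply: mem_powsetM uB _.
  by rewrite -[4%N]/(1 + 1 + 1 + 1)%N !mem_powsetM // powset1 ?mem_invg.
move=> /sumsetP[_ [e2 [/sumsetP[v1 [e1 [v1B e1E ->]]] e2E ->]]] vB.
rewrite !addrA (_ : n + 10 = 1 + n + 1 + 4 + 4)%N; last first.
  by rewrite add1n addn1 -!addnA !addSn -!addnS.
apply: (addE _ _ _ e2E); apply: (addE _ _ _ e1E).
rewrite mem_iota_set in v1B.
rewrite -[v1 in v + v1]/(iota_heis (v1 : G)) dblD_conj.
by rewrite !mem_powsetM // powset1.
Qed.

Lemma dbl_nsumset v n : v \in nsumset D n -> dbl v \in powset B (n * 10).
Proof.
elim: n v => [|n IHn] v.
  by move=> /fset1P->; rewrite /dbl mul0rn fset11.
move=> /sumsetP[d [w [dD wD ->]]]; rewrite addrC mulSn addnC.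
exact: dblD_thickening (IHn _ wD).
Qed.

(** Brackets have first coordinate 0, so only the [n] summands from [B] count, and their product in
    [G] has the same first coordinate as their sum. *)
Lemma nsumset_fst v n :
  v \in nsumset D n -> exists2 g, g \in powset B n & g.1 = v.1.
Proof.
elim: n v => [|n IHn] v; first by move=> /fset1P->; exists 1%g; rewrite ?fset11.
move=> /sumsetP[d [w [/sumsetP[d' [e2 [/sumsetP[v1 [e1 [v1B]]]]]]]]].
move=> /bracketsP[g1 [h1 [_ _ ->]]] ->.
move=> /bracketsP[g2 [h3 [_ _ ->]]] -> /IHn[g gB gw] ->.
rewrite mem_iota_set in v1B; exists ((v1 : G) * g)%g; first exact: mem_prodset.
by rewrite heis_mulE /= !addr0 gw.
Qed.

(* An element of [nD] is determined by the product of a representative in [B^n]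
   of its first coordinate with the double of its offset, which lies in
   [0 x W], from a representative in [nD]. *)
Lemma card_nsumset_thickening n :
  (#|` nsumset D n| <= #|` powset B (n + (n + n) * 10)|)%N.
Proof.
have [s sP] := fset_section (1%g : G) (powset B n) fst.
have [t tP] := fset_section (0 : Z * W) (nsumset D n) fst.
have {}sP v : v \in nsumset D n -> s v.1 \in powset B n /\ (s v.1).1 = v.1.
  by move=> /nsumset_fst[g /sP[gB gE] <-].
apply: (@leq_card_inj _ _ (fun v => (s v.1 * dbl (v - t v.1))%g : G)).
  (* The offset from the representative [t u.1] has first coordinate 0, so the product still shows
     [u.1]. *)
  have fstE u : u \in nsumset D n -> (s u.1 * dbl (u - t u.1))%g.1 = u.1.
    move=> uD; have [_ su] := sP _ uD; have [_ tu] := tP _ uD.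
    rewrite -[LHS]/((s u.1).1 + ((u.1 - (t u.1).1) + (u.1 - (t u.1).1))).
    by rewrite tu subrr !addr0.
  move=> v v' vD v'D E0.
  have v1E : v.1 = v'.1 by rewrite -fstE // E0 fstE.
  move: E0; rewrite v1E => /mulgI E1.
  rewrite [v]surjective_pairing [v']surjective_pairing v1E; congr pair.
  (* Only twice the second coordinates are compared by [E1]; the absence of 2-torsion cancels the
     2. *)
  apply/eqP; rewrite -subr_eq0; apply/eqP/h2; rewrite mulrnBl.
  have : v.2 - (t v'.1).2 + (v.2 - (t v'.1).2) =
         v'.2 - (t v'.1).2 + (v'.2 - (t v'.1).2) := congr1 snd E1.
  by rewrite ![_ - _ + (_ - _)]addrACA -!mulr2n => /addIr ->; rewrite subrr.
move=> v vD; have [svB _] := sP _ vD; have [tvD _] := tP _ vD.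
(* The offset is a difference of two elements of [nD], hence in [2nD] by symmetry; this gives the
   exponent [(n + n) * 10]. *)
apply: mem_powsetM svB _; apply: dbl_nsumset; apply: mem_nsumsetD => //.
exact: nsumset_oppr thickening_oppr _ tvD.
Qed.

(** First coordinates of [D + D] are sums of two from [B]. Biadditivity expands a bracket into four
    elements of [E], two for each copy of [D]. *)
Lemma bracket_sumset_thickening :
  embW Z (bracketset b (projZ (sumset D D)) (projZ (sumset D D)))
    `<=` sumset D D.
Proof.
have projD z : z \in projZ (sumset D D) ->
    exists g h, [/\ g \in B, h \in B & z = g.1 + h.1].
  have fstD v : v \in D -> exists2 g, g \in B & v.1 = g.1.
    move=> vD; have := nsumset_fst (n := 1); rewrite nsumset1 => /(_ _ vD).
    by rewrite powset1 => -[g gB <-]; exists g.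
  move=> /imfsetP[_ /= /sumsetP[v [w [/fstD[g gB gE] /fstD[h hB hE] ->]]] ->].
  by exists g, h; rewrite -gE -hE.
have memDE e e' : e \in E -> e' \in E -> e + e' \in D.
  by move=> eE e'E; rewrite -[e]add0r !mem_sumset // iota_set0.
have memE g h : g \in B -> h \in B -> (0, b g.1 h.1) \in E.
  by move=> gB hB; apply/bracketsP; exists g, h.
apply/fsubsetP => _ /imfsetP[_ /= /imfset2P[z zP [z' z'P ->]] ->].
have [g [h [gB hB ->]]] := projD _ zP.
have [g' [h' [g'B h'B ->]]] := projD _ z'P.
rewrite hb.1 !hb.2.
rewrite [X in X \in _](_ : _ = ((0, b g.1 g'.1) + (0, b g.1 h'.1)) +
   ((0, b h.1 g'.1) + (0, b h.1 h'.1))).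
  by rewrite mem_sumset ?memDE ?memE.
by rewrite -[RHS]/(0 + 0 + (0 + 0), _) !addr0.
Qed.

End Thickening.

End HeisenbergSets.

(** * Choice of the constant and assembly of the approximate subgroup *)

Theorem theorem7p12 (R : realType) :
  exists C : R, 0 < C /\
  forall (Z W : zmodType) (b : Z -> Z -> W) (hb : biadditive b),
    antisym_bracket b -> no_2torsion W ->
  forall (A : {fset heisenberg hb}) (K : R),
    A != fset0 -> 1 <= K ->
    #|` prodset (prodset A A) A|%:R <= K * #|` A|%:R ->
  exists At : {fset Z * W},
    [/\ approx_addsubgroup (C * K `^ C) At,
        embW Z (bracketset b (projZ At) (projZ At)) `<=` At,
        [fset iota_heis g | g in A] `<=` At &
        C^-1 * K `^ (- C) * #|` At|%:R <= #|` A|%:R].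
Proof.
(* [c * K ^+ 312] is [(32 * K ^+ 3) ^+ 104], the bound on [|5D| / |A|]. The 2 allows for
   symmetrising the centres, and the sum [312 + 2 * c] serves both as factor and as exponent. *)
pose c : R := 32 ^+ 104; exists (312 + 2 * c).
have c0 : 0 <= c by rewrite exprn_ge0.
have C0 : 0 < 312 + 2 * c by rewrite ltr_wpDr ?mulr_ge0.
split=> // Z W b hb ha h2 A K A0 K1 AAA.
have K0 : 0 <= K by apply: le_trans K1.
pose B := symset A; pose D := thickening B; pose At := sumset D D.
have B1 : 1%g \in B by rewrite !inE eqxx.
have BV : invset B = B := invset_symset A.
have B0 : B != fset0 by apply/fset0Pn; exists 1%g.
have AB : A `<=` B by apply/fsubsetP => g gA; rewrite !inE gA orbT.
have D0 : 0 \in D := thickening0 B1.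
have DN := thickening_oppr ha h2 BV.
have AD : [fset iota_heis g | g in A] `<=` D.
  apply/fsubsetP => _ /imfsetP[g /= gA ->]; apply: (mem_thickening_B B1).
  by rewrite mem_iota_set; exact: (fsubsetP AB).
have D5 : #|` nsumset D 5|%:R <= c * K ^+ 312 * #|` A|%:R.
  have B3 : #|` powset B 3|%:R <= 32 * K ^+ 3 * #|` A|%:R.
    exact: card_symset_tripling.
  have M0 : 0 <= 32 * K ^+ 3 by rewrite mulr_ge0 ?exprn_ge0.
  (* Here [105 = 5 + 10 * 10]; as [105 = 102 + 3], the growth of powers costs 103 factors
     [32 * K ^+ 3]. One more replaces [|B|] by [|A|], since [|B|] is at most [|B^3|]. *)
  apply: le_trans (_ : #|` powset B 105|%:R <= _).
    by rewrite ler_nat; exact: (card_nsumset_thickening ha h2 BV 5).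
  have B3B : #|` powset B 3|%:R <= 32 * K ^+ 3 * #|` B|%:R.
    by apply: le_trans B3 _; rewrite ler_wpM2l // ler_nat fsubset_leq_card.
  apply: le_trans (card_powset_tripling 102 B0 BV M0 B3B) _.
  have -> : c * K ^+ 312 * #|` A|%:R =
      (32 * K ^+ 3) ^+ 103 * (32 * K ^+ 3 * #|` A|%:R).
    by rewrite mulrA -exprSr exprMn -exprM.
  rewrite ler_wpM2l ?exprn_ge0 //; apply: le_trans B3; rewrite ler_nat.
  rewrite -{1}(powset1 B); apply: leq_trans (leq_card_prodsetl _ B1) _.
  exact: leq_card_prodsetl B1.
have CK : 2 * c * K ^+ 312 <= (312 + 2 * c) * K `^ (312 + 2 * c).
  apply: ler_pM; rewrite ?mulr_ge0 ?exprn_ge0 ?lerDr //.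
  rewrite -powR_mulrn //; apply: ler_powR => //.
  by rewrite lerDl mulr_ge0.
have A0R : 0 < #|` A|%:R :> R by rewrite ltr0n cardfs_gt0.
have cardAD : (#|` A| <= #|` D|)%N.
  by apply: (@leq_card_inj _ _ (@iota_heis _ _ _ hb)) => // g gA;
    apply: (fsubsetP AD); apply: in_imfset.
(* Covering [4D] by translates of [D - D] needs at most [|5D| / |D|] centres, and [|D|] is at least
   [|A|]. *)
have [|X [X4 XD Xcov]] := @ruzsa_covering _ (nsumset D 4) D.
  by apply/fset0Pn; exists 0.
have At4 : sumset At At = nsumset D 4 by rewrite (nsumset_add D 2 2) nsumset2.
exists At; split.
- split.
  + by apply/fset0Pn; exists 0; rewrite -[0]addr0 mem_sumset.
  + exact: oppset_id (sumset_oppr DN DN).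
  (* The centres must form a symmetric set, at the price of a factor 2. *)
  + exists (X `|` oppset X); split.
    * rewrite At4; apply/fsubsetP => v; rewrite inE mem_oppset.
      move=> /orP[/(fsubsetP X4)//|/(fsubsetP X4)/(nsumset_oppr DN)].
      by rewrite opprK.
    * by apply: oppset_id => v; rewrite !inE !mem_oppset opprK orbC.
    * apply: le_trans CK.
      apply: le_trans (_ : 2 * #|` X|%:R <= _).
        rewrite -natrM ler_nat cardfsU mul2n -addnn.
        by apply: leq_trans (leq_subr _ _) _; rewrite leq_add2l leq_imfset_card.
      rewrite -mulrA ler_pM2l // -(ler_pM2r A0R); apply: le_trans D5.
      rewrite -natrM ler_nat (nsumset_add D 4 1) nsumset1.
      by apply: leq_trans XD; rewrite leq_mul2l cardAD orbT.
    (* By symmetry of [D], the difference [d - d'] lies in [D + D], which is [At]. *)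
    * rewrite At4; apply/fsubsetP => v /Xcov[x [d [d' [xX dD d'D ->]]]].
      by rewrite !mem_sumset ?DN // inE xX.
- exact: bracket_sumset_thickening.
- apply: fsubset_trans AD _; rewrite /At -nsumset2 -{1}(nsumset1 D).
  exact: nsumset_sub.
- rewrite powRN -invfM mulrC ler_pdivrMr ?mulr_gt0 ?powR_gt0 //; last first.
    exact: lt_le_trans K1.
  apply: le_trans (_ : #|` nsumset D 5|%:R <= _).
    by rewrite ler_nat /At -nsumset2 fsubset_leq_card // nsumset_sub.
  apply: le_trans D5 _; rewrite mulrC ler_wpM2l //; apply: le_trans CK.
  by rewrite -mulrA ler_peMl ?mulr_ge0 ?exprn_ge0 // ler1n.
Qed.
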